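(* Let $f:\mathbb{R}^n\to\mathbb{R}$ be twice differentiable with $\mu I\preceq \nabla^2 f(x)\preceq L I$ for all $x$ (where $0<\mu\le L$), and strongly self-concordant with constant $M\ge 0$. Let $\kappa=L/\mu$. Run the SR1 method with correction strategy: choose $x_0\in\mathbb{R}^n$, set $G_0=L\cdot I$, $r_{-1}=0$, and for $k=0,1,2,\dots$ set $x_{k+1}=x_k-G_k^{-1}\nabla f(x_k)$, $u_k=x_{k+1}-x_k$, $r_k=\|u_k\|_{x_k}$, $\widetilde G_k=\left(1+\frac{Mr_{k-1}}{2}\right)\left(1+\frac{Mr_k}{2}\right)G_k$, $J_k=\int_0^1\nabla^2 f(x_k+tu_k)\,dt$, and $G_{k+1}=\mathrm{SR1}(J_k,\widetilde G_k,u_k)$. Suppose the initial point satisfies $M\lambda_f(x_0)\le \frac{\ln(3/2)}{4\kappa}$. Then for all $k\ge 1$, $$\lambda_f(x_k)\le\left(e^{\frac{2n\ln(e\kappa)}{k}}-1\right)^{k/2}\sqrt{3\kappa}\cdot\lambda_f(x_0).$$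
   Context: $f$ is strongly self-concordant with constant $M\ge0$ if $\nabla^2 f(y)-\nabla^2 f(x)\preceq M\|y-x\|_z\nabla^2 f(w)$ for all $x,y,z,w\in\mathbb{R}^n$, where $\|u\|_x=\sqrt{u^\top\nabla^2 f(x)u}$ is the local norm. $\lambda_f(x)=\langle\nabla f(x),[\nabla^2 f(x)]^{-1}\nabla f(x)\rangle^{1/2}$. $\preceq$ is the Loewner order. For symmetric positive definite $A,G$ and $u\neq 0$, the SR1 update is $\mathrm{SR1}(A,G,u)=G$ if $(G-A)u=0$, and otherwise $\mathrm{SR1}(A,G,u)=G-\frac{(G-A)uu^\top(G-A)}{u^\top(G-A)u}$. *)

(* Defs.v *)
From HB Require Import structures.
From mathcomp Require Import all_boot all_order all_algebra.
From mathcomp Require Import all_classical all_reals all_analysis.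
Set Implicit Arguments. Unset Strict Implicit. Unset Printing Implicit Defensive.
Import Order.TTheory GRing.Theory Num.Theory.
Import numFieldNormedType.Exports.
Local Open Scope classical_set_scope.
Local Open Scope ring_scope.

Section SR1Defs.
Variables (R : realType) (n : nat).

Definition ebasis (i : 'I_n) : 'cV[R]_n := delta_mx i 0.

Definition grad (f : 'cV[R]_n -> R) (x : 'cV[R]_n) : 'cV[R]_n :=
  \col_i ('D_(ebasis i) f x).

Definition hess (f : 'cV[R]_n -> R) (x : 'cV[R]_n) : 'M[R]_n :=
  \matrix_(i, j) ('D_(ebasis j) (fun y => grad f y i 0) x).

Definition qform (A : 'M[R]_n) (u : 'cV[R]_n) : R := (u^T *m A *m u) 0 0.

Definition loewner_le (A B : 'M[R]_n) : Prop :=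
  forall u : 'cV[R]_n, 0 <= qform (B - A) u.

Definition lnorm (f : 'cV[R]_n -> R) (x u : 'cV[R]_n) : R :=
  Num.sqrt (qform (hess f x) u).

Definition newton_dec (f : 'cV[R]_n -> R) (x : 'cV[R]_n) : R :=
  Num.sqrt (qform (invmx (hess f x)) (grad f x)).

Definition strongly_self_concordant (f : 'cV[R]_n -> R) (M : R) : Prop :=
  0 <= M /\
  forall x y z w : 'cV[R]_n,
    loewner_le (hess f y - hess f x) ((M * lnorm f z (y - x)) *: hess f w).

Definition SR1 (A G : 'M[R]_n) (u : 'cV[R]_n) : 'M[R]_n :=
  if (G - A) *m u == 0 then G
  else G - (qform (G - A) u)^-1 *: ((G - A) *m u *m u^T *m (G - A)).

Definition avg_hess (f : 'cV[R]_n -> R) (x u : 'cV[R]_n) : 'M[R]_n :=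
  \matrix_(i, j) (\int[lebesgue_measure]_(t in `[0%R, 1%R])
                      (hess f (x + t *: u) i j)).

Definition sr1_step (f : 'cV[R]_n -> R) (M : R)
  (s : 'cV[R]_n * 'M[R]_n * R) : 'cV[R]_n * 'M[R]_n * R :=
  let: (x, G, rprev) := s in
  let x' := x - invmx G *m grad f x in
  let u := x' - x in
  let r := lnorm f x u in
  let Gt := ((1 + M * rprev / 2) * (1 + M * r / 2)) *: G in
  let J := avg_hess f x u in
  (x', SR1 J Gt u, r).

Definition sr1_state (f : 'cV[R]_n -> R) (M L : R) (x0 : 'cV[R]_n) (k : nat) :=
  iter k (sr1_step f M) (x0, L%:M, 0).

Definition sr1_iter (f : 'cV[R]_n -> R) (M L : R) (x0 : 'cV[R]_n) (k : nat)
  : 'cV[R]_n := (sr1_state f M L x0 k).1.1.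

End SR1Defs.

(* Main.v *)
(* With the correction factors c_k = (1 + M r_(k-1) / 2) (1 + M r_k / 2), strong
self-concordance gives J_k <= c_k G_k, so every SR1 update keeps
J_k <= G_(k+1) <= c_k G_k.  The initial condition makes lambda contract by
1 - 1 / (2 kappa), hence M r_0 + M r_1 + ... <= ln (3/2) and
G_k <= (3/2) L I along the whole run.

The superlinear rate comes from the potential N_k = g_k^T G_k^-1 g_k.  With
s = (c G - J) u and rho = u^T s, the matrix determinant lemma turns
a = s^T G_(k+1)^-1 s / rho into c^n det G_k = (1 + a) det G_(k+1), while the
secant equation G_(k+1) u = J u gives N_(k+1) <= (a + (c - 1)^2) N_k.  So the
product of the 1 + a_i + (c_i - 1)^2 is bounded through det G_0 / det G_k,
which is at most kappa^n, and the arithmetic-geometric mean inequality bounds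
the product of the ratios a_i + (c_i - 1)^2 themselves. *)

Require Import Defs.
From HB Require Import structures.
From mathcomp Require Import all_boot all_order all_algebra.
From mathcomp Require Import all_classical all_reals all_analysis.
From mathcomp Require Import ring lra.
Import Order.TTheory GRing.Theory Num.Theory.
Import numFieldNormedType.Exports.
Local Open Scope ring_scope.

Set Implicit Arguments.
Unset Strict Implicit.
Unset Printing Implicit Defensive.

(** ** Quadratic forms and positive definite matrices *)

Section LinAlg.
Variable R : realType.
Implicit Type n : nat.

Definition dot n (u v : 'cV[R]_n) : R := (u^T *m v) 0 0.

Lemma dotE n (u v : 'cV[R]_n) : dot u v = \sum_i u i 0 * v i 0.
Proof. by rewrite /dot !mxE; apply: eq_bigr => i _; rewrite mxE. Qed.

Lemma dotC n (u v : 'cV[R]_n) : dot u v = dot v u.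
Proof. by rewrite !dotE; apply: eq_bigr => i _; rewrite mulrC. Qed.

Lemma dotDr n (u v w : 'cV[R]_n) : dot u (v + w) = dot u v + dot u w.
Proof. by rewrite /dot mulmxDr mxE. Qed.

Lemma dotDl n (u v w : 'cV[R]_n) : dot (u + v) w = dot u w + dot v w.
Proof. by rewrite dotC dotDr !(dotC w). Qed.

Lemma dotZr n a (u v : 'cV[R]_n) : dot u (a *: v) = a * dot u v.
Proof. by rewrite /dot -scalemxAr mxE. Qed.

Lemma dotZl n a (u v : 'cV[R]_n) : dot (a *: u) v = a * dot u v.
Proof. by rewrite dotC dotZr dotC. Qed.

Lemma dotNr n (u v : 'cV[R]_n) : dot u (- v) = - dot u v.
Proof. by rewrite -scaleN1r dotZr mulN1r. Qed.

Lemma dotNl n (u v : 'cV[R]_n) : dot (- u) v = - dot u v.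
Proof. by rewrite dotC dotNr dotC. Qed.

Lemma dot0r n (u : 'cV[R]_n) : dot u 0 = 0.
Proof. by rewrite /dot mulmx0 mxE. Qed.

Definition dotp := (dotDl, dotDr, dotZl, dotZr, dotNl, dotNr).

Lemma dot_ge0 n (u : 'cV[R]_n) : 0 <= dot u u.
Proof. by rewrite dotE sumr_ge0// => i _; rewrite -expr2 sqr_ge0. Qed.

Lemma dot_gt0 n (u : 'cV[R]_n) : u != 0 -> 0 < dot u u.
Proof.
move=> u0; rewrite lt_def dot_ge0 andbT; apply: contra u0.
rewrite dotE psumr_eq0 => [/allP uu0|i _]; last by rewrite -expr2 sqr_ge0.
apply/eqP/matrixP => i j; rewrite ord1 mxE.
by have /= := uu0 i (mem_index_enum i); rewrite mulf_eq0 orbb => /eqP.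
Qed.

Lemma dot_mull n (A : 'M[R]_n) (u v : 'cV[R]_n) :
  dot (A *m u) v = dot u (A^T *m v).
Proof. by rewrite /dot trmx_mul mulmxA. Qed.

Lemma qformE n (A : 'M[R]_n) (u : 'cV[R]_n) : qform A u = dot u (A *m u).
Proof. by rewrite /qform /dot mulmxA. Qed.

Lemma qformZm n a (A : 'M[R]_n) u : qform (a *: A) u = a * qform A u.
Proof. by rewrite !qformE -scalemxAl dotZr. Qed.

Lemma qformBm n (A B : 'M[R]_n) u : qform (A - B) u = qform A u - qform B u.
Proof. by rewrite !qformE mulmxBl dotDr dotNr. Qed.

Lemma qform_scalar n a (u : 'cV[R]_n) : qform a%:M u = a * dot u u.
Proof. by rewrite qformE mul_scalar_mx dotZr. Qed.

Lemma loewnerP n (A B : 'M[R]_n) :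
  loewner_le A B <-> forall u, qform A u <= qform B u.
Proof.
by split => AB u; have := AB u; rewrite qformBm subr_ge0.
Qed.

Definition posdef n (A : 'M[R]_n) :=
  A^T = A /\ forall u, u != 0 -> 0 < qform A u.

Lemma posdef_ge n (A : 'M[R]_n) a : 0 < a -> A^T = A ->
  loewner_le a%:M A -> posdef A.
Proof.
move=> a0 sA /loewnerP aA; split=> // u u0.
by apply: lt_le_trans (aA u); rewrite qform_scalar mulr_gt0// dot_gt0.
Qed.

Lemma posdef_ge0 n (A : 'M[R]_n) u : posdef A -> 0 <= qform A u.
Proof.
move=> [_ pA]; have [->|/pA/ltW//] := eqVneq u 0.
by rewrite qformE mulmx0 dot0r.
Qed.

Lemma posdef_unit n (A : 'M[R]_n) : posdef A -> A \in unitmx.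
Proof.
move=> [sA pA]; rewrite -row_free_unit; apply: inj_row_free => v vA.
apply/eqP; apply: contraT => v0.
have /pA : v^T != 0 by rewrite -trmx0 (inj_eq trmx_inj).
by rewrite /qform trmxK vA mul0mx mxE ltxx.
Qed.

Lemma posdef_inv_sym n (A : 'M[R]_n) : posdef A -> (invmx A)^T = invmx A.
Proof. by move=> [sA _]; rewrite trmx_inv sA. Qed.

Lemma qform_inv n (A : 'M[R]_n) u : posdef A ->
  qform (invmx A) (A *m u) = qform A u.
Proof.
by move=> pA; rewrite !qformE mulKmx ?posdef_unit// dotC.
Qed.

Lemma posdef_inv n (A : 'M[R]_n) : posdef A -> posdef (invmx A).
Proof.
move=> pA; split; first exact: posdef_inv_sym.
move=> u u0; rewrite -[u](mulKVmx (posdef_unit pA)) qform_inv//.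
apply: pA.2; apply: contra u0 => /eqP A0.
by rewrite -[u](mulKVmx (posdef_unit pA)) A0 mulmx0.
Qed.

Lemma posdefZ n (A : 'M[R]_n) a : 0 < a -> posdef A -> posdef (a *: A).
Proof.
move=> a0 [sA pA]; split; first by rewrite linearZ/= sA.
by move=> u u0; rewrite qformZm mulr_gt0// pA.
Qed.

(** Expand the nonnegative form of [A] at [y - z], where [y = B^-1 x] and [z = A^-1 x]: it gives
    [2 y.x <= y.Ay + x.z], while [y.Ay <= y.By = y.x]. *)
Lemma invmx_antitone n (A B : 'M[R]_n) : posdef A -> posdef B ->
  loewner_le A B -> loewner_le (invmx B) (invmx A).
Proof.
move=> pA pB /loewnerP AB; apply/loewnerP => x.
set y := invmx B *m x; set z := invmx A *m x.
have : 0 <= qform A (y - z) by exact: posdef_ge0.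
have Az : A *m z = x by rewrite mulKVmx// posdef_unit.
have By : B *m y = x by rewrite mulKVmx// posdef_unit.
have zA : dot z (A *m y) = dot y x by rewrite -pA.1 -dot_mull Az dotC.
have := AB y; rewrite !qformE By mulmxBr Az !dotp zA -/y -/z.
rewrite (dotC x y) (dotC x z); lra.
Qed.

(** Cauchy-Schwarz for a possibly degenerate form, by evaluating it at [v] minus its projection on
    [u]. Applied to [G - A], it keeps an SR1 update above its target. *)
Lemma psd_CS n (A : 'M[R]_n) u v : A^T = A -> (forall w, 0 <= qform A w) ->
  0 < qform A u -> dot u (A *m v) ^+ 2 / qform A u <= qform A v.
Proof.
move=> sA pA u0; set b := dot _ _; set q := qform A u in u0 *.
have := pA (v - (b / q) *: u).
have vu : dot v (A *m u) = b by rewrite dotC dot_mull sA.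
rewrite qformE mulmxBr -scalemxAr !dotp vu -/b -!qformE -/q.
move=> h; rewrite -subr_ge0; apply: le_trans h _; rewrite le_eqVlt; apply/orP; left; apply/eqP.
by field; rewrite gt_eqF.
Qed.

Lemma psd_ker n (A : 'M[R]_n) u : A^T = A -> (forall w, 0 <= qform A w) ->
  qform A u = 0 -> A *m u = 0.
Proof.
move=> sA pA q0; apply/eqP; apply: contraT => /dot_gt0.
set v := A *m u => v0; set c := qform A v.
(* The form is evaluated at [u - t v] with [t = |v|^2 / (c + 1)], where [v != 0] would make it
   negative; the [+ 1] covers [c = 0]. *)
have c0 : 0 < c + 1 by rewrite ltr_wpDl// pA.
have := pA (u - (dot v v / (c + 1)) *: v).
have vAu : dot u (A *m v) = dot v v by rewrite -{1}sA -dot_mull.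
have uv : dot u v = 0 by rewrite -q0 qformE.
rewrite qformE mulmxBr -scalemxAr !dotp vAu -/v -(qformE A v) -/c uv => h.
have : 0 <= - (dot v v ^+ 2 * (c + 2) / (c + 1) ^+ 2).
  apply: le_trans h _; rewrite le_eqVlt; apply/orP; left; apply/eqP.
  by field; rewrite gt_eqF.
have c2 : 0 < c + 2 by lra.
by rewrite oppr_ge0 leNgt divr_gt0// ?mulr_gt0// exprn_gt0.
Qed.

(* Comparing the forms of D at x + y and x - y bounds its off-diagonal
   values, here at y = A^-1 D x. *)
Lemma sandwich_contraction n (A D : 'M[R]_n) q x : 0 < q -> posdef A ->
  D^T = D ->
  (forall u, `|qform D u| <= q * qform A u) ->
  qform (invmx A) (D *m x) <= q ^+ 2 * qform A x.
Proof.
move=> q0 pA sD DA; set y := invmx A *m (D *m x).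
have Ay : A *m y = D *m x by rewrite mulKVmx// posdef_unit.
have -> : qform (invmx A) (D *m x) = qform A y.
  by rewrite -Ay qform_inv.
have yDx : dot y (D *m x) = qform A y by rewrite qformE Ay.
have xDy : dot x (D *m y) = qform A y by rewrite -sD -dot_mull dotC.
have yAx : dot y (A *m x) = dot x (D *m x).
  by rewrite -pA.1 -dot_mull Ay dotC.
have xAy : dot x (A *m y) = dot x (D *m x) by rewrite Ay.
have /ler_normlP[_ h1] := DA (q *: x + y).
have /ler_normlP[h2 _] := DA (q *: x - y).
move: h1 h2; rewrite !qformE !(mulmxDr, mulmxN) -!scalemxAr !dotp.
rewrite yDx xDy yAx xAy -!qformE; move: (qform A x) (qform A y) (qform D x) (qform D y) => X Y V W h1 h2.
(* Adding [h1] and [h2] cancels [V] and [W] and leaves [4 q Y <= 2 q (q^2 X + Y)]. *)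
have : q * Y <= q * (q ^+ 2 * X) by nra.
by rewrite ler_pM2l.
Qed.

(** The block matrix [X] is made triangular in two ways: clearing [t^T] leaves [B + s t^T] on the
    diagonal, clearing [-s] leaves [B] and the scalar factor. *)
Lemma det_rank1 n (B : 'M[R]_n) (s t : 'cV[R]_n) : B \in unitmx ->
  \det (B + s *m t^T) = \det B * (1 + dot t (invmx B *m s)).
Proof.
move=> uB.
pose X := block_mx B (- s) t^T (1%:M : 'M[R]_1).
have h1 : X *m block_mx 1%:M 0 (- t^T) 1%:M = block_mx (B + s *m t^T) (- s) 0 1%:M.
  by rewrite mulmx_block !mulmx1 !mulmx0 mul1mx !add0r mulmxN mulNmx opprK subrr.
have h2 : X = block_mx B 0 t^T 1%:M *m
  block_mx 1%:M (- (invmx B *m s)) 0 (1 + t^T *m (invmx B *m s)).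
  rewrite mulmx_block !mulmx1 !mul1mx !mulmx0 !mul0mx !addr0 !mulmxN.
  by rewrite mulKVmx// [1 + _]addrC addKr.
have : \det X = \det (B + s *m t^T).
  by have := congr1 determinant h1; rewrite det_mulmx det_lblock !det1 !mulr1 det_ublock det1 mulr1.
move=> <-; rewrite h2 det_mulmx det_lblock det_ublock !det1 mulr1 mul1r.
by rewrite det_mx11 mxE {1}mxE eqxx mulr1n.
Qed.

Lemma dot_col_mx m n (a c : 'cV[R]_m) (b d : 'cV[R]_n) :
  dot (col_mx a b) (col_mx c d) = dot a c + dot b d.
Proof. by rewrite /dot tr_col_mx mul_row_col mxE. Qed.

(** Elimination of the first row and column: the determinant is the pivot [x >= a] times that of the
    Schur complement [S], which inherits the lower bound [a]. *)
Lemma det_ge n (A : 'M[R]_n) a : 0 < a -> A^T = A -> loewner_le a%:M A ->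
  a ^+ n <= \det A.
Proof.
move=> a0; elim: n A => [A _ _|n IH]; first by rewrite det_mx00.
rewrite -[n.+1]/(1 + n)%N => A sA /loewnerP aA.
set x := ulsubmx A 0 0; set b := dlsubmx A; set D := drsubmx A.
have bT : ursubmx A = b^T by rewrite /b trmx_dlsub sA.
have DT : D^T = D by rewrite /D trmx_drsub sA.
have AE : A = block_mx x%:M b^T b D.
  by rewrite -bT -[LHS]submxK [in LHS](mx11_scalar (ulsubmx A)).
have ax : a <= x.
  have := aA (col_mx 1%:M 0); rewrite qform_scalar qformE {1}AE.
  rewrite mul_block_col !mulmx0 !mulmx1 !addr0 !dot_col_mx.
  by rewrite (dotC 0 b) !dot0r !addr0 !dotE !big_ord1 !mxE eqxx !mulr1n !mulr1 mul1r.
have x0 : 0 < x := lt_le_trans a0 ax.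
pose S := D - x^-1 *: (b *m b^T).
have detA : \det A = x * \det S.
  have : A *m block_mx 1%:M (- (x^-1 *: b^T)) 0 1%:M = block_mx x%:M 0 b S.
    rewrite {1}AE mulmx_block !mulmx1 !mulmx0 !addr0 !mulmxN.
    rewrite mul_scalar_mx scalerA divff ?gt_eqF// scale1r addrC subrr.
    by rewrite -scalemxAr addrC.
  move/(congr1 determinant); rewrite det_mulmx det_ublock det_lblock !det1 !mulr1.
  by move=> ->; rewrite det_mx11 mxE eqxx mulr1n.
rewrite detA exprS; apply: ler_pM => //; rewrite ?exprn_ge0 ?(ltW a0)//.
apply: IH; first by rewrite linearB/= linearZ/= trmx_mul trmxK DT.
apply/loewnerP => v; rewrite qform_scalar.
(* This [t] minimises the form of [A] over the vectors [col_mx t v], and the minimum is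
   [qform S v]. *)
pose t : 'cV[R]_1 := - (x^-1 *: (b^T *m v)).
have := aA (col_mx t v); rewrite qform_scalar qformE {1}AE mul_block_col.
rewrite mul_scalar_mx /t scalerN scalerA divff ?gt_eqF// scale1r addNr.
rewrite !dot_col_mx dot0r add0r -/t => h.
have -> : qform S v = dot v (b *m t + D *m v).
  rewrite qformE mulmxBl -scalemxAl /t mulmxN -scalemxAr mulmxA.
  by rewrite [in RHS]addrC.
by apply: le_trans h; rewrite ler_pM2l// lerDr dot_ge0.
Qed.

End LinAlg.

(** ** Derivatives along lines and the averaged Hessian *)

Section Calc.
Local Open Scope classical_set_scope.
Variables (R : realType) (n : nat).
Implicit Types (f : 'cV[R]_n -> R) (x u v : 'cV[R]_n).

Lemma cV_sum_ebasis u : u = \sum_i u i 0 *: ebasis R i.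
Proof.
apply/matrixP => i j; rewrite ord1 summxE (bigD1 i)//= !mxE !eqxx mulr1.
by rewrite big1 ?addr0// => k ki; rewrite !mxE eq_sym (negbTE ki) mulr0.
Qed.

Lemma is_derive_line (V : normedModType R) (f : 'cV[R]_n -> V) x u (t : R) :
  differentiable f (x + t *: u) ->
  is_derive t 1 (fun s : R => f (x + s *: u)) ('d f (x + t *: u) u).
Proof.
move=> df; have := derivableP (diff_derivable (v := u) df).
rewrite deriveE// => -[dfu dfuE].
have E : (fun h : R => h^-1 *: (((fun s : R => f (x + s *: u)) \o shift t) (h *: 1)
            - f (x + t *: u))) =
         (fun h : R => h^-1 *: ((f \o shift (x + t *: u)) (h *: u) - f (x + t *: u))).
  apply/funext => h /=; congr (_ *: (f _ - _)).
  by rewrite [h%:A]mulr1 scalerDl addrCA addrA addrC addrA.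
split; first by rewrite /derivable E.
by rewrite -dfuE /derive E.
Qed.

Lemma differentiable_grad_coord f x i : differentiable (grad f) x ->
  differentiable (fun y => grad f y i 0) x.
Proof.
move=> dg.
exact: (@differentiable_comp _ _ _ _ (grad f) (fun N : 'cV[R]_n => N i 0 : R) _ dg
  (differentiable_coord _ _ _)).
Qed.

Lemma hess_mul f x u i : differentiable (grad f) x ->
  (hess f x *m u) i 0 = 'd (fun y => grad f y i 0) x u.
Proof.
move=> dg; rewrite {2}[u]cV_sum_ebasis linear_sum mxE.
apply: eq_bigr => j _; rewrite linearZ mxE deriveE//= 1?mulrC//.
exact: differentiable_grad_coord.
Qed.

Lemma diff_little_o (V W : normedModType R) (g : V -> W) (x : V) (e : R) :
  differentiable g x -> 0 < e ->
  exists2 d : R, 0 < d &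
    forall h, `|h| < d -> `|g (x + h) - g x - 'd g x h| <= e * `|h|.
Proof.
move=> dg e0; have := diff_locally dg; set k := 'o _ => gE.
have /(littleoP [littleo of k]) /nbhs_ballP[d d0 Hd] := e0.
exists d => // h hd.
have -> : g (x + h) - g x - 'd g x h = k h.
  have /(congr1 (fun F : V -> W => F h)) /= := gE.
  rewrite [x + h]addrC => ->.
  by rewrite -[X in X = _]addrA -opprD addrAC subrr add0r.
by apply: Hd; rewrite -ball_normE/= add0r normrN.
Qed.

(* Apply the mean value theorem along ebasis i.  Only differentiability of the
   gradient at x is used, so no continuity of the second derivatives is needed
   for the symmetry of the Hessian. *)
Lemma second_difference f x v i (e : R) :
  (forall y, differentiable f y) -> differentiable (grad f) x -> 0 < e ->
  exists2 d : R, 0 < d & forall t, 0 < t -> t < d ->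
    `|f (x + t *: v + t *: ebasis R i) - f (x + t *: ebasis R i)
      - f (x + t *: v) + f x - t ^+ 2 * (hess f x *m v) i 0|
    <= e * t ^+ 2 * (`|v| + 2 * `|ebasis R i|).
Proof.
move=> df dg e0; set u := ebasis R i; rewrite (hess_mul _ _ dg).
have dgi := differentiable_grad_coord i dg.
set g := fun y => grad f y i 0 in dgi *.
have [d d0 Hd] := diff_little_o dgi e0.
have K0 : 0 < `|u| + `|v| + 1 by rewrite ltr_wpDl// addr_ge0.
exists (d / (`|u| + `|v| + 1)) => [|t t0]; first exact: divr_gt0.
rewrite ltr_pdivlMr// => td.
(* The increment of [psi] over [[0, t]] is the second difference. Its derivative is a difference of
   two values of [g], each linearised at [x]; the terms along [u] cancel and [t] times the
   differential at [v] remains. *)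
pose psi (s : R) := f (x + t *: v + s *: u) - f (x + s *: u).
have gE y : 'd f y u = g y by rewrite -deriveE// /g mxE.
have dpsi (s : R) : is_derive s 1 psi (g (x + t *: v + s *: u) - g (x + s *: u)).
  by rewrite -!gE; apply: is_deriveB; apply: is_derive_line.
have cpsi : {within `[0, t], continuous psi}.
  by apply: derivable_within_continuous => s _; exact: ex_derive.
have [xi xi0t] := MVT t0 (fun s _ => dpsi s) cpsi.
move: xi0t; rewrite in_itv/= => /andP[xi0 xit]; rewrite subr0.
rewrite {1 2}/psi !scale0r !addr0 => psiE.
have h1 : `|g (x + (t *: v + xi *: u)) - g x - 'd g x (t *: v + xi *: u)| <=
    e * (t * (`|v| + `|u|)).
  have nh : `|t *: v + xi *: u| <= t * (`|v| + `|u|).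
    apply: le_trans (ler_normD _ _) _; rewrite !normrZ !gtr0_norm// mulrDr lerD2l.
    by rewrite ler_wpM2r// ltW.
  apply: le_trans (Hd _ _) _; last by rewrite ler_pM2l.
  by apply: le_lt_trans nh _; nra.
have h2 : `|g (x + xi *: u) - g x - 'd g x (xi *: u)| <= e * (t * `|u|).
  have nh : `|xi *: u| <= t * `|u|.
    by rewrite normrZ gtr0_norm// ler_wpM2r// ltW.
  apply: le_trans (Hd _ _) _; last by rewrite ler_pM2l.
  apply: le_lt_trans nh _; have := normr_ge0 v; nra.
move: h1 h2; rewrite addrA linearD !linearZ/=.
move/ler_normlP => [h1 h1'] /ler_normlP[h2 h2'].
have -> : f (x + t *: v + t *: u) - f (x + t *: u) - f (x + t *: v) + f x =
  f (x + t *: v + t *: u) - f (x + t *: u) - (f (x + t *: v) - f x) by ring.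
rewrite psiE; move: h1 h1' h2 h2'.
move: (g (x + t *: v + xi *: u)) (g (x + xi *: u)) (g x) ('d g x v) ('d g x u) => a b c p q.
rewrite /GRing.scale/= => h1 h1' h2 h2'.
have -> : (a - b) * t + t ^+ 2 * - p = (a - b - t * p) * t by ring.
have -> : e * t ^+ 2 * (`|v| + 2 * `|u|) = e * (t * (`|v| + 2 * `|u|)) * t by ring.
rewrite normrM (gtr0_norm t0) ler_pM2r//; apply/ler_normlP; split; nra.
Qed.

(** The second difference along two basis vectors does not depend on their order, and it
    approximates [t^2] times each of the two mirrored entries. *)
Lemma hess_sym f x : (forall y, differentiable f y) -> differentiable (grad f) x ->
  (hess f x)^T = hess f x.
Proof.
move=> df dg; apply/matrixP => i j; rewrite [LHS]mxE.
have HE k l : (hess f x *m ebasis R l) k 0 = hess f x k l.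
  by rewrite /ebasis -colE mxE.
apply/eqP; rewrite -subr_eq0 -normr_le0 leNgt; apply/negP.
set D := `|_| => D0.
pose K := 2 * (`|ebasis R i| + `|ebasis R j| : R).
have K0 : 0 <= K by rewrite mulr_ge0// addr_ge0.
(* With this [e], [2 e K < D], against the bound [D <= 2 e K] drawn from the two expansions. *)
pose e := D / (2 * K + 1).
have e0 : 0 < e by rewrite divr_gt0// ltr_wpDl// mulr_ge0.
have [d1 d10 H1] := second_difference (ebasis R i) j df dg e0.
have [d2 d20 H2] := second_difference (ebasis R j) i df dg e0.
pose t := Num.min d1 d2 / 2.
have m0 : 0 < Num.min d1 d2 by rewrite lt_min d10 d20.
have t0 : 0 < t by rewrite divr_gt0.
have tm : t < Num.min d1 d2 by rewrite /t; lra.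
have t1 : t < d1 by apply: lt_le_trans tm _; rewrite ge_min lexx.
have t2 : t < d2 by apply: lt_le_trans tm _; rewrite ge_min lexx orbT.
move: (H1 t t0 t1) (H2 t t0 t2); rewrite !HE.
rewrite [x + _ *: ebasis R j + _ *: _]addrAC.
set F := f (x + _ + _).
set F1 := f (x + t *: ebasis R i); set F2 := f (x + t *: ebasis R j).
have nj : `|ebasis R i| + 2 * `|ebasis R j| <= K.
  by rewrite /K; have := normr_ge0 (ebasis R i); lra.
have ni : `|ebasis R j| + 2 * `|ebasis R i| <= K.
  by rewrite /K; have := normr_ge0 (ebasis R j); lra.
have et0 : 0 <= e * t ^+ 2 by rewrite mulr_ge0// ?sqr_ge0// ltW.
move=> /le_trans /(_ (ler_wpM2l et0 nj)) /ler_normlP[a1 a2].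
move=> /le_trans /(_ (ler_wpM2l et0 ni)) /ler_normlP[b1 b2].
have DE : D * t ^+ 2 <= 2 * (e * t ^+ 2 * K).
  have -> : D * t ^+ 2 = `|(hess f x j i - hess f x i j) * t ^+ 2|.
    by rewrite normrM (ger0_norm (sqr_ge0 t)).
  by apply/ler_normlP; split; lra.
have : D <= 2 * e * K.
  by rewrite -(ler_pM2r (exprn_gt0 2 t0)); apply: le_trans DE _; lra.
have : e * (2 * K + 1) = D by rewrite /e divfK//; apply: lt0r_neq0; lra.
move=> eD D2; have : e <= 0.
  by lra.
by rewrite leNgt e0.
Qed.

End Calc.

(** * Integration over the unit interval *)

Section UnitIntegral.
Local Open Scope classical_set_scope.
Variable R : realType.
Implicit Type F G : R -> R.

Notation int01 F := (\int[lebesgue_measure]_(t in `[0%R, 1%R]) F t).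

Lemma continuous_integrable01 F : continuous F ->
  (@lebesgue_measure R).-integrable `[0, 1] (EFin \o F).
Proof.
move=> cF; apply: continuous_compact_integrable; first exact: segment_compact.
exact: continuous_subspaceT.
Qed.

Lemma le_int01 F G : continuous F -> continuous G ->
  (forall t, 0 <= t <= 1 -> F t <= G t) -> int01 F <= int01 G.
Proof.
move=> cF cG FG; apply: le_Rintegral => //; exact: continuous_integrable01.
Qed.

Lemma int01_deriv F (dF : R -> R) : continuous dF ->
  (forall t : R, is_derive t 1 F (dF t)) -> int01 dF = F 1 - F 0.
Proof.
move=> cdF dFE; rewrite /Rintegral (@continuous_FTC2 _ dF F)//.
- exact: continuous_subspaceT.
- have cF t : {for t, continuous F}.
    by apply/differentiable_continuous/derivable1_diffP.
  split; first by [].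
    by apply: cvg_at_right_filter; exact: cF.
  by apply: cvg_at_left_filter; exact: cF.
- by move=> t _; rewrite derive1E derive_val.
Qed.

Lemma int01_affine (a b : R) : int01 (fun t => a + b * t) = a + b / 2.
Proof.
pose F (t : R) : R := a * t + b / 2 * t ^+ 2.
have dF (t : R) : is_derive t 1 F (a + b * t).
  by rewrite /F; apply: is_derive_eq; rewrite /GRing.scale/=; lra.
rewrite (int01_deriv _ dF).
  by rewrite /F expr1n !mulr1 expr0n/= !mulr0 addr0 subr0.
move=> t; apply: cvgD; first exact: cvg_cst.
by apply: cvgM; [exact: cvg_cst|exact: cvg_id].
Qed.

Lemma continuous_affine (a b : R) : continuous (fun t : R => a + b * t).
Proof.
move=> t; apply: cvgD; first exact: cvg_cst.
by apply: cvgM; [exact: cvg_cst|exact: cvg_id].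
Qed.

(** Bounds growing linearly along a segment integrate to half their slope; this is the origin of the
    halves in [1 + M r / 2]. *)
Lemma int01_le_affine F (a b : R) : continuous F ->
  (forall t, 0 <= t <= 1 -> F t <= a + b * t) -> int01 F <= a + b / 2.
Proof.
by move=> cF Fab; rewrite -int01_affine; apply: le_int01 => //; exact: continuous_affine.
Qed.

Lemma int01_ge_affine F (a b : R) : continuous F ->
  (forall t, 0 <= t <= 1 -> a + b * t <= F t) -> a + b / 2 <= int01 F.
Proof.
by move=> cF Fab; rewrite -int01_affine; apply: le_int01 => //; exact: continuous_affine.
Qed.

Lemma int01_sum (I : Type) (s : seq I) (c : I -> R) (F : I -> R -> R) :
  (forall i, continuous (F i)) ->
  int01 (fun t => \sum_(i <- s) c i * F i t) = \sum_(i <- s) c i * int01 (F i).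
Proof.
move=> cF.
have cM i : continuous (fun t => c i * F i t).
  by move=> t; apply: cvgM; [exact: cvg_cst|exact: cF].
have cS (r : seq I) : continuous (fun t => \sum_(i <- r) c i * F i t).
  apply: continuous_big => // -[x y]; exact: add_continuous.
elim: s => [|i s IH].
  rewrite big_nil; under eq_Rintegral do rewrite big_nil.
  by rewrite Rintegral_cst// mul0r.
rewrite big_cons -IH; under eq_Rintegral do rewrite big_cons.
by rewrite RintegralD ?RintegralZl//; exact: continuous_integrable01.
Qed.

End UnitIntegral.

(** * The averaged Hessian under strong self-concordance *)

Section SelfConcordance.
Local Open Scope classical_set_scope.
Variables (R : realType) (n : nat) (f : 'cV[R]_n -> R) (M : R).
Hypothesis df : forall x, differentiable f x.
Hypothesis dg : forall x, differentiable (grad f) x.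
Hypothesis H_ge0 : forall x v, 0 <= qform (hess f x) v.
Hypothesis ssc : strongly_self_concordant f M.
Implicit Types x u v w : 'cV[R]_n.

Let H x := hess f x.
Let Hsym x : (H x)^T = H x := hess_sym df (dg x).

Lemma qformZ (A : 'M[R]_n) a u : qform A (a *: u) = a ^+ 2 * qform A u.
Proof. by rewrite !qformE -scalemxAr dotZl dotZr mulrA expr2. Qed.

Lemma lnormZ x a u : lnorm f x (a *: u) = `|a| * lnorm f x u.
Proof. by rewrite /lnorm qformZ sqrtrM ?sqr_ge0// sqrtr_sqr. Qed.

(** The point of the local norm is free in strong self-concordance; fixing it at [x] makes the bound
    proportional to [|t - s|] along the whole line. *)
Lemma hess_line_le x u s t w v :
  qform (H (x + t *: u)) v - qform (H (x + s *: u)) v <=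
  M * (`|t - s| * lnorm f x u) * qform (H w) v.
Proof.
have := ssc.2 (x + s *: u) (x + t *: u) x w v.
rewrite qformBm qformZm qformBm [x + t *: u]addrC addrKA -scalerBl lnormZ.
by rewrite addrC subr_ge0 [x + _]addrC.
Qed.

(** The Hessian is not assumed continuous. Strong self-concordance with [w = x] makes its forms
    Lipschitz along a line, with constant [K]. *)
Lemma continuous_qform_hess_line x u v :
  continuous (fun t : R => qform (H (x + t *: u)) v).
Proof.
move=> t; set K := M * lnorm f x u * qform (H x) v.
have K0 : 0 <= K by rewrite !mulr_ge0// ?sqrtr_ge0// ssc.1.
have KE s s' : qform (H (x + s *: u)) v - qform (H (x + s' *: u)) v <= K * `|s - s'|.
  apply: le_trans (hess_line_le _ _ _ _ x v) _; rewrite /K; lra.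
have /cvgrPdist_lt tt := @cvg_id R (nbhs t).
apply/cvgrPdist_lt => e e0; near=> s.
have : `|t - s| * (K + 1) < e.
  rewrite -ltr_pdivlMr ?ltr_wpDl//.
  by near: s; apply: tt; rewrite divr_gt0// ltr_wpDl.
apply: le_lt_trans.
apply: (@le_trans _ _ (K * `|t - s|)).
  apply/ler_normlP; split; last exact: KE.
  by rewrite opprB distrC KE.
by rewrite mulrC ler_wpM2l// lerDl.
Unshelve. all: by end_near. Qed.

(** Transfers continuity from the quadratic forms to the entries, through which [avg_hess] is
    defined. *)
Lemma polarization (A : 'M[R]_n) i j : A^T = A ->
  A i j = (qform A (ebasis R i + ebasis R j) - qform A (ebasis R i - ebasis R j)) / 4.
Proof.
move=> sA.
have Ae k l : dot (ebasis R k) (A *m ebasis R l) = A k l.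
  rewrite -colE dotE (bigD1 k)//= big1 ?addr0 => [|m mk].
    by rewrite !mxE !eqxx mul1r.
  by rewrite !mxE (negbTE mk) mul0r.
rewrite !qformE mulmxDr mulmxBr !dotp !Ae.
have -> : A j i = A i j by rewrite -{1}sA mxE.
by field.
Qed.

Lemma continuous_hess_line x u i j : continuous (fun t : R => H (x + t *: u) i j).
Proof.
have -> : (fun t : R => H (x + t *: u) i j) = (fun t =>
  (qform (H (x + t *: u)) (ebasis R i + ebasis R j) -
   qform (H (x + t *: u)) (ebasis R i - ebasis R j)) / 4).
  by apply/funext => t; apply: polarization.
move=> t; apply: cvgM; last exact: cvg_cst.
by apply: cvgB; exact: continuous_qform_hess_line.
Qed.

Notation J x u := (avg_hess f x u).

Lemma dot_avg_hess x u v w :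
  dot v (J x u *m w) = \int[lebesgue_measure]_(t in `[0, 1]) dot v (H (x + t *: u) *m w).
Proof.
have dotmE (A : 'M[R]_n) :
    dot v (A *m w) = \sum_(p : 'I_n * 'I_n) (v p.1 0 * w p.2 0) * A p.1 p.2.
  rewrite dotE -(pair_bigA _ (fun i j => v i 0 * w j 0 * A i j))/=.
  apply: eq_bigr => i _; rewrite mxE mulr_sumr; apply: eq_bigr => j _.
  by rewrite mulrAC mulrA.
under eq_Rintegral do rewrite dotmE.
rewrite dotmE int01_sum => [|p]; last exact: continuous_hess_line.
by apply: eq_bigr => p _; rewrite mxE.
Qed.

Lemma qform_avg_hess x u v :
  qform (J x u) v = \int[lebesgue_measure]_(t in `[0, 1]) qform (H (x + t *: u)) v.
Proof.
by rewrite qformE dot_avg_hess; apply: eq_Rintegral => t _; rewrite qformE.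
Qed.

Lemma avg_hess_sym x u : (J x u)^T = J x u.
Proof.
apply/matrixP => i j; rewrite !mxE; apply: eq_Rintegral => t _.
by have /matrixP/(_ i j) := Hsym (x + t *: u); rewrite mxE.
Qed.

(** The fundamental theorem of calculus for each coordinate of the gradient along the segment. *)
Lemma avg_hess_mul x u : J x u *m u = grad f (x + u) - grad f x.
Proof.
apply/matrixP => i j; rewrite ord1 [RHS]mxE [X in _ + X]mxE.
have Ae (A : 'M[R]_n) : (A *m u) i 0 = dot (ebasis R i) (A *m u).
  rewrite dotE (bigD1 i)//= big1 ?addr0 => [|m mk].
    by rewrite [ebasis R i i 0]mxE !eqxx mul1r.
  by rewrite [ebasis R i m 0]mxE (negbTE mk) mul0r.
rewrite Ae dot_avg_hess.
under eq_Rintegral do rewrite -Ae.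
have dG (t : R) : is_derive t 1 (fun s : R => grad f (x + s *: u) i 0)
    ((H (x + t *: u) *m u) i 0).
  rewrite hess_mul//.
  by apply: (@is_derive_line _ _ _ (fun y => grad f y i 0)); exact: differentiable_grad_coord.
rewrite (int01_deriv _ dG); first by rewrite scale1r scale0r addr0.
rewrite (_ : (fun s : R => _) = fun s : R => \sum_j H (x + s *: u) i j * u j 0).
  apply: continuous_big => [[a b]|k _ s]; first exact: add_continuous.
  by apply: cvgM; [exact: continuous_hess_line|exact: cvg_cst].
by apply/funext => s; rewrite mxE.
Qed.

(** Since [s] is an endpoint, [|t - s|] is affine on the unit interval and has mean 1/2. *)
Lemma avg_hess_le x u s w v : s = 0 \/ s = 1 ->
  qform (J x u) v - qform (H (x + s *: u)) v <= M * lnorm f x u / 2 * qform (H w) v.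
Proof.
move=> s01; rewrite [X in X - _]qform_avg_hess.
set q := (X in _ - X); set p := (X in _ <= _ * X).
set b := M * lnorm f x u * p; rewrite lerBlDl.
have -> : M * lnorm f x u / 2 * p = b / 2 by rewrite /b; ring.
have Ht t : qform (H (x + t *: u)) v <= q + `|t - s| * b.
  by rewrite -lerBlDl; apply: le_trans (hess_line_le _ _ _ _ w _) _; rewrite /b -/p; lra.
case: s01 => s01.
- apply: int01_le_affine; first exact: continuous_qform_hess_line.
  move=> t /andP[t0 t1]; apply: le_trans (Ht t) _.
  by rewrite s01 subr0 ger0_norm// mulrC.
- have -> : q + b / 2 = (q + b) + (- b) / 2 by field.
  apply: int01_le_affine; first exact: continuous_qform_hess_line.
  move=> t /andP[t0 t1]; apply: le_trans (Ht t) _.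
  by rewrite s01 ler0_norm ?subr_le0//; lra.
Qed.

Lemma avg_hess_ge x u s w v : s = 0 \/ s = 1 ->
  qform (H (x + s *: u)) v - qform (J x u) v <= M * lnorm f x u / 2 * qform (H w) v.
Proof.
move=> s01; rewrite [X in _ - X]qform_avg_hess.
set q := (X in X - _); set p := (X in _ <= _ * X).
set b := M * lnorm f x u * p; rewrite lerBlDl -lerBlDr.
have -> : M * lnorm f x u / 2 * p = b / 2 by rewrite /b; ring.
have Ht t : q - `|t - s| * b <= qform (H (x + t *: u)) v.
  rewrite lerBlDl -lerBlDr; apply: le_trans (hess_line_le _ _ _ _ w _) _.
  by rewrite distrC /b -/p; lra.
case: s01 => s01.
- have -> : q - b / 2 = q + (- b) / 2 by field.
  apply: int01_ge_affine; first exact: continuous_qform_hess_line.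
  move=> t /andP[t0 t1]; apply: le_trans (Ht t).
  by rewrite s01 subr0 ger0_norm//; lra.
- have -> : q - b / 2 = (q - b) + b / 2 by field.
  apply: int01_ge_affine; first exact: continuous_qform_hess_line.
  move=> t /andP[t0 t1]; apply: le_trans (Ht t).
  by rewrite s01 ler0_norm ?subr_le0//; lra.
Qed.

Lemma avg_hess_le_hess x u s : s = 0 \/ s = 1 ->
  loewner_le (J x u) ((1 + M * lnorm f x u / 2) *: H (x + s *: u)).
Proof.
move=> s01; apply/loewnerP => v; rewrite qformZm mulrDl mul1r -lerBlDl.
exact: avg_hess_le.
Qed.

(* The bound of avg_hess_ge holds for every w, so it may be averaged over
   w on the segment. *)
Lemma hess_le_avg_hess x u s : s = 0 \/ s = 1 ->
  loewner_le (H (x + s *: u)) ((1 + M * lnorm f x u / 2) *: J x u).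
Proof.
move=> s01; apply/loewnerP => v; rewrite qformZm mulrDl mul1r -lerBlDl.
set e := M * _ / 2; set d := _ - _.
have e0 : 0 <= e by rewrite divr_ge0// mulr_ge0 ?sqrtr_ge0// ssc.1.
have [E0|en0] := eqVneq e 0.
  by have := avg_hess_ge x u x v s01; rewrite -/e -/d E0 !mul0r.
rewrite mulrC -ler_pdivrMr ?lt_def ?en0// qform_avg_hess.
have -> : d / e = d / e + 0 / 2 by rewrite mul0r addr0.
apply: int01_ge_affine; first exact: continuous_qform_hess_line.
move=> t _; rewrite mul0r addr0 ler_pdivrMr ?lt_def ?en0// mulrC.
exact: avg_hess_ge.
Qed.

Lemma avg_hess_ge_scalar mu x u : (forall y, loewner_le mu%:M (H y)) ->
  loewner_le mu%:M (J x u).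
Proof.
move=> muH; apply/loewnerP => v; rewrite qform_avg_hess.
rewrite -[qform mu%:M v]addr0 -[X in _ + X](mul0r 2^-1).
apply: int01_ge_affine; first exact: continuous_qform_hess_line.
by move=> t _; rewrite mul0r addr0; have /loewnerP := muH (x + t *: u).
Qed.

End SelfConcordance.

(** ** The SR1 update *)

Section SR1Update.
Variables (R : realType) (n : nat).
Implicit Types (A B G : 'M[R]_n) (g u v : 'cV[R]_n) (c : R).

Lemma qform_invZ A c g : 0 < c -> posdef A ->
  qform (invmx (c *: A)) g = c^-1 * qform (invmx A) g.
Proof.
move=> c0 pA.
by rewrite invmxZ ?qformZm// unitmxZ ?posdef_unit// unitfE gt_eqF.
Qed.

Lemma qform_inv_le A B c g : 0 < c -> posdef A -> posdef B ->
  loewner_le A (c *: B) -> qform (invmx B) g <= c * qform (invmx A) g.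
Proof.
move=> c0 pA pB AB.
have /loewnerP/(_ g) := invmx_antitone pA (posdefZ c0 pB) AB.
by rewrite qform_invZ// ler_pdivrMl.
Qed.

(** This bounds the local length of a step by the Newton decrement. With [y = G^-1 g] and
    [z = A^-1 g], combine [y.Ay <= c y.g] with the nonnegativity of the form of [A] at [y - c z]. *)
Lemma qform_inv_step_le A G c g : 0 < c -> posdef A -> posdef G ->
  loewner_le A (c *: G) ->
  qform A (invmx G *m g) <= c ^+ 2 * qform (invmx A) g.
Proof.
move=> c0 pA pG /loewnerP AG; set y := invmx G *m g; set z := invmx A *m g.
have Az : A *m z = g by rewrite mulKVmx// posdef_unit.
have Gy : G *m y = g by rewrite mulKVmx// posdef_unit.
have := AG y; rewrite qformZm [qform G y]qformE Gy.
have zAy : dot z (A *m y) = dot y g by rewrite -pA.1 -dot_mull Az dotC.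
have : 0 <= qform A (y - c *: z) by exact: posdef_ge0.
rewrite qformE mulmxBr -scalemxAr Az !dotp zAy -(qformE A y).
rewrite [qform (invmx A) g]qformE -/z (dotC g z).
move: (dot y g) (dot z g) (qform A y) => p q r; nra.
Qed.

(** The vector is [A D g] with [D = A^-1 - G^-1], and inverting the two Loewner bounds places [D]
    between [-(c - 1) A^-1] and [(1 - k^-1) A^-1]. *)
Lemma quasi_newton_contraction A G c k q g :
  0 < c -> 0 < k -> 0 < q -> posdef A -> posdef G ->
  loewner_le A (c *: G) -> loewner_le G (k *: A) ->
  c - 1 <= q -> 1 - k^-1 <= q ->
  qform (invmx A) (g - A *m (invmx G *m g)) <= q ^+ 2 * qform (invmx A) g.
Proof.
move=> c0 k0 q0 pA pG AG GA cq kq.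
pose D := invmx A - invmx G.
have pAi := posdef_inv pA; have pGi := posdef_inv pG.
have -> : g - A *m (invmx G *m g) = A *m (D *m g).
  by rewrite mulmxBl mulmxBr mulKVmx// posdef_unit.
rewrite qform_inv// -[A in X in X <= _]invmxK.
apply: sandwich_contraction => //.
  by rewrite linearB/= pAi.1 pGi.1.
move=> u; rewrite qformBm.
have h1 := qform_inv_le u c0 pA pG AG.
have h2 := qform_inv_le u k0 pG pA GA.
have A0 := posdef_ge0 u pAi.
have h3 : k^-1 * qform (invmx A) u <= qform (invmx G) u by rewrite ler_pdivrMl.
move: h1 h3 A0; move: (k^-1) kq (qform _ _) (qform _ _) => l lq a b h1 h3 a0.
by apply/ler_normlP; split; nra.
Qed.

Lemma SR1_sym A G u : A^T = A -> G^T = G -> (SR1 A G u)^T = SR1 A G u.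
Proof.
move=> sA sG; rewrite /SR1; case: ifP => // _.
have sR : (G - A)^T = G - A by rewrite linearB/= sA sG.
by rewrite linearB/= linearZ/= sG !trmx_mul trmxK sR -!mulmxA.
Qed.

Lemma SR1E A G u : A^T = A -> G^T = G -> (G - A) *m u != 0 ->
  SR1 A G u = G - (qform (G - A) u)^-1 *: (((G - A) *m u) *m ((G - A) *m u)^T).
Proof.
move=> sA sG /negbTE s0; rewrite /SR1 s0.
have sR : (G - A)^T = G - A by rewrite linearB/= sA sG.
by rewrite trmx_mul sR -!mulmxA.
Qed.

Lemma qform_rank1 u v : qform (u *m u^T) v = dot u v ^+ 2.
Proof.
rewrite qformE -mulmxA [u^T *m v]mx11_scalar mul_mx_scalar dotZr.
by rewrite -/(dot u v) (dotC v) expr2.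
Qed.

(** The update subtracts a positive semidefinite rank-one matrix from [G], and by Cauchy-Schwarz for
    [G - A] that matrix is at most [G - A]. *)
Lemma SR1_bounds A G u : A^T = A -> G^T = G -> loewner_le A G ->
  loewner_le A (SR1 A G u) /\ loewner_le (SR1 A G u) G.
Proof.
move=> sA sG AG.
have sR : (G - A)^T = G - A by rewrite linearB/= sA sG.
have [s0|s0] := eqVneq ((G - A) *m u) 0.
  rewrite /SR1 s0 eqxx; split=> //; apply/loewnerP => v; exact: lexx.
set rho := qform (G - A) u.
(* A semidefinite form vanishes only on its kernel, so [s0] excludes a zero denominator. *)
have rho0 : 0 < rho.
  by rewrite lt_def AG andbT; apply: contra s0 => /eqP/(psd_ker sR AG)/eqP.
rewrite SR1E// -/rho; split; apply/loewnerP => v; rewrite qformBm qformZm qform_rank1.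
  rewrite lerBrDl -lerBrDr -qformBm dot_mull sR mulrC.
  exact: psd_CS.
by rewrite lerBlDr lerDl mulr_ge0 ?sqr_ge0// invr_ge0 ltW.
Qed.

Lemma SR1_potential A G u c : 1 <= c -> posdef A -> posdef G ->
  loewner_le A (c *: G) ->
  let G' := SR1 A (c *: G) u in
  posdef G' ->
  exists2 a, 0 <= a &
    c ^+ n * \det G = (1 + a) * \det G' /\
    qform (invmx G') (A *m u - G *m u) <= (a + (c - 1) ^+ 2) * qform G u.
Proof.
move=> c1 pA pG AG G' pG'; have c0 : 0 < c by lra.
have pcG := posdefZ c0 pG.
have sR : (c *: G - A)^T = c *: G - A by rewrite linearB/= pA.1 pcG.1.
have detcG : \det (c *: G) = c ^+ n * \det G by rewrite detZ.
set s := (c *: G - A) *m u.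
have cGu : c *: (G *m u) = s + A *m u by rewrite /s mulmxBl scalemxAl subrK.
have ci : c * c^-1 = 1 by rewrite divff// gt_eqF.
have ci0 : 0 < c^-1 by rewrite invr_gt0.
(* In the method this vector is the next gradient. It is split along [s] and [A u]; the latter
   equals [G' u], on which [G'^-1] acts trivially. *)
have gE : A *m u - G *m u = (1 - c^-1) *: (A *m u) - c^-1 *: s.
  have -> : G *m u = c^-1 *: (s + A *m u).
    by rewrite -cGu scalerA mulrC ci scale1r.
  by rewrite scalerBl scale1r scalerDr opprD addrA addrAC.
have N0 := posdef_ge0 u pG; have j0 := posdef_ge0 u pA.
(* If [s = 0], then [G' = c G] and [a = 0] serves. *)
have [s0|s0] := eqVneq s 0.
  have G'E : G' = c *: G by rewrite /G' /SR1 -/s s0 eqxx.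
  exists 0 => //; rewrite addr0 mul1r G'E detcG; split=> //.
  have AuE : A *m u = (c *: G) *m u by rewrite -scalemxAl cGu s0 add0r.
  rewrite gE s0 scaler0 subr0 AuE scalemxAr qform_inv// qformZ qformZm add0r.
  have -> : (1 - c^-1) ^+ 2 * (c * qform G u) = (c - 1) ^+ 2 * qform G u * c^-1.
    by field; rewrite gt_eqF.
  by apply: ler_piMr; [rewrite mulr_ge0 ?sqr_ge0|rewrite invf_le1].
set rho := qform (c *: G - A) u.
have rho0 : 0 < rho.
  by rewrite lt_def AG andbT; apply: contra s0 => /eqP/(psd_ker sR AG)/eqP.
have rhoE : dot u s = rho by rewrite /rho qformE.
have G'E : G' = c *: G - rho^-1 *: (s *m s^T).
  by rewrite /G' SR1E ?pA.1 ?pcG.1.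
have G'u : G' *m u = A *m u.
  rewrite G'E mulmxBl -!scalemxAl cGu -mulmxA [s^T *m u]mx11_scalar mul_mx_scalar.
  by rewrite -/(dot s u) dotC rhoE scalerA mulVf ?gt_eqF// scale1r addrAC subrr add0r.
set p := qform (invmx G') s.
have p0 : 0 <= p by apply: posdef_ge0; exact: posdef_inv.
exists (p / rho); first exact: divr_ge0 p0 (ltW rho0).
split.
  rewrite -detcG mulrC.
  have -> : c *: G = G' + (rho^-1 *: s) *m s^T by rewrite G'E -scalemxAl subrK.
  rewrite det_rank1 ?posdef_unit//; congr (_ * (1 + _)).
  by rewrite -scalemxAr dotZr -qformE mulrC.
have uG's : dot (G' *m u) (invmx G' *m s) = rho.
  by rewrite dot_mull pG'.1 mulKVmx// posdef_unit.
have NE : c * qform G u = rho + qform A u.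
  by rewrite /rho qformBm qformZm subrK.
rewrite gE -G'u qformE mulmxBr -!scalemxAr mulKmx ?posdef_unit// !dotp.
rewrite uG's (dotC s u) rhoE -(qformE (invmx G') s) -/p dotC -(qformE G') .
have -> : qform G' u = qform A u by rewrite !qformE G'u.
have NE' : qform G u = c^-1 * (rho + qform A u) by rewrite -NE mulrA [c^-1 * c]mulrC ci mul1r.
rewrite NE'.
have -> : p = (p / rho) * rho by rewrite divfK// gt_eqF.
rewrite mulfK ?gt_eqF//.
have a0 : 0 <= p / rho := divr_ge0 p0 (ltW rho0).
move: (p / rho) (qform A u) a0 j0 => a j a0 j0.
(* Multiplied by [c^2], the left side is [(c - 1)^2 j - 2 (c - 1) rho + a rho]. Its middle term is
   nonpositive because [c >= 1], and on the right one factor [c >= 1] may be dropped. *)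
rewrite -(ler_pM2l (exprn_gt0 2 c0)).
have -> : c ^+ 2 * ((a + (c - 1) ^+ 2) * (c^-1 * (rho + j))) =
   c * ((a + (c - 1) ^+ 2) * (rho + j)) by field; rewrite gt_eqF.
apply: (@le_trans _ _ ((c - 1) ^+ 2 * j - 2 * (c - 1) * rho + a * rho)).
  by rewrite le_eqVlt; apply/orP; left; apply/eqP; field; rewrite gt_eqF.
have h1 : 0 <= (c - 1) ^+ 2 := sqr_ge0 _.
have h2 : 0 <= (c - 1) * rho by rewrite mulr_ge0 ?(ltW rho0)// subr_ge0.
have h3 : 0 <= (a + (c - 1) ^+ 2) * (rho + j).
  by rewrite mulr_ge0 ?addr_ge0// ltW.
apply: (@le_trans _ _ ((a + (c - 1) ^+ 2) * (rho + j))); last by rewrite ler_peMl.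
have h4 : 0 <= a * j by rewrite mulr_ge0.
have h5 : 0 <= (c - 1) ^+ 2 * rho by rewrite mulr_ge0// ltW.
by lra.
Qed.

End SR1Update.

(** ** One step of the method *)

Lemma AGM_ord (R : realType) k (E : 'I_k -> R) : (forall i, 0 <= E i) ->
  \prod_i E i <= ((\sum_i E i) / k%:R) ^+ k.
Proof.
move=> E0; have [+ _] := @leif_AGM R 'I_k 'I_k E (fun i _ => E0 i).
have -> : #|'I_k| = k := card_ord k.
by [].
Qed.

(** Apply the mean inequality to the [b_i / (1 + b_i)], of mean [m], and to the [1 / (1 + b_i)], of
    mean [1 - m]. The second gives [1 / (1 + B) <= 1 - m], so [m (1 + B) <= B]; the first bounds the
    product of the [b_i] by [m^k (1 + B)^k]. *)
Lemma prod_le_of_prod1D_ord (R : realType) k (b : 'I_k -> R) (B : R) :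
  (0 < k)%N -> 0 < B -> (forall i, 0 <= b i) ->
  \prod_i (1 + b i) <= (1 + B) ^+ k -> \prod_i b i <= B ^+ k.
Proof.
move=> k0 B0 b0 hB.
have b1 i : 0 < 1 + b i by rewrite ltr_wpDr.
have kr : 0 < k%:R :> R by rewrite ltr0n.
have B1 : 0 < 1 + B by rewrite addr_gt0.
pose m := (\sum_i b i / (1 + b i)) / k%:R.
have mE : (\sum_i (1 + b i)^-1) / k%:R = 1 - m.
  apply/eqP; rewrite eq_sym subr_eq -mulrDl -big_split/=.
  rewrite (eq_bigr (fun=> 1)) => [|i _]; last first.
    by rewrite -[X in X + _]mul1r -mulrDl divff ?gt_eqF.
  by rewrite sumr_const card_ord divff// gt_eqF.
have h1 : \prod_i (b i / (1 + b i)) <= m ^+ k.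
  by apply: AGM_ord => i; rewrite divr_ge0// ltW.
have h2 : \prod_i (1 + b i)^-1 <= (1 - m) ^+ k.
  by rewrite -mE; apply: AGM_ord => i; rewrite invr_ge0 ltW.
have m0 : 0 <= m.
  by rewrite divr_ge0 ?(ltW kr)// sumr_ge0// => i _; rewrite divr_ge0// ltW.
have m1 : 0 <= 1 - m.
  by rewrite -mE divr_ge0 ?(ltW kr)// sumr_ge0// => i _; rewrite invr_ge0 ltW.
have P0 : 0 < \prod_i (1 + b i) by rewrite prodr_gt0.
have hm : (1 + B)^-1 <= 1 - m.
  rewrite -(@ler_pXn2r _ k)// ?nnegrE ?invr_ge0 ?(ltW B1)//.
  by apply: le_trans h2; rewrite prodfV exprVn lef_pV2// posrE exprn_gt0.
have hm' : m * (1 + B) <= B.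
  have : (1 + B)^-1 * (1 + B) <= (1 - m) * (1 + B) by rewrite ler_pM2r.
  by rewrite mulVf ?gt_eqF//; lra.
have -> : \prod_i b i = \prod_i (b i / (1 + b i)) * \prod_i (1 + b i).
  by rewrite -big_split/=; apply: eq_bigr => i _; rewrite divfK// gt_eqF.
apply: (@le_trans _ _ (m ^+ k * (1 + B) ^+ k)).
  by apply: ler_pM => //; [apply: prodr_ge0 => i _; rewrite divr_ge0// ltW|exact: ltW].
rewrite -exprMn; apply: lerXn2r => //; rewrite nnegrE ?(ltW B0)//.
exact: mulr_ge0 m0 (ltW B1).
Qed.

Lemma prod_le_of_prod1D (R : realType) (s : seq R) (B : R) : 0 < B ->
  (forall b, b \in s -> 0 <= b) ->
  \prod_(b <- s) (1 + b) <= (1 + B) ^+ size s ->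
  \prod_(b <- s) b <= B ^+ size s.
Proof.
move=> B0 s0; have [->|s_nil] := eqVneq s [::]; first by rewrite !big_nil expr0.
have nthE (F : R -> R) : \prod_(b <- s) F b = \prod_(i < size s) F s`_i.
  by rewrite (big_nth 0) big_mkord.
rewrite (nthE (fun b => 1 + b)) (nthE id).
apply: prod_le_of_prod1D_ord => //; first by rewrite lt0n size_eq0.
by move=> i; apply/s0/mem_nth.
Qed.

Section Method.
Variables (R : realType) (n : nat) (f : 'cV[R]_n -> R) (mu L M : R).
Hypothesis mu0 : 0 < mu.
Hypothesis muL : mu <= L.
Hypothesis df : forall x, differentiable f x.
Hypothesis dg : forall x, differentiable (grad f) x.
Hypothesis hessB : forall x,
  loewner_le mu%:M (hess f x) /\ loewner_le (hess f x) L%:M.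
Hypothesis ssc : strongly_self_concordant f M.

Lemma hess_posdef x : posdef (hess f x).
Proof. by apply: (posdef_ge mu0); [exact: hess_sym|exact: (hessB x).1]. Qed.

Let hess_ge0 x v : 0 <= qform (hess f x) v := posdef_ge0 v (hess_posdef x).

Lemma newton_dec_sqr x :
  newton_dec f x ^+ 2 = qform (invmx (hess f x)) (grad f x).
Proof. by rewrite sqr_sqrtr// posdef_ge0//; exact: posdef_inv (hess_posdef x). Qed.

Lemma newton_dec_le x a b : 0 <= b ->
  qform (invmx (hess f x)) (grad f x) <= b ^+ 2 * a ^+ 2 -> 0 <= a ->
  newton_dec f x <= b * a.
Proof.
by move=> b0 h a0; rewrite -(@ler_pXn2r _ 2)// ?nnegrE ?sqrtr_ge0 ?mulr_ge0//
  newton_dec_sqr exprMn.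
Qed.

Section Step.
Variables (x : 'cV[R]_n) (G : 'M[R]_n) (rp : R) (x' : 'cV[R]_n) (G' : 'M[R]_n) (r : R).
Hypothesis stepE : sr1_step f M (x, G, rp) = (x', G', r).
Hypothesis rp0 : 0 <= rp.
Hypothesis Gsym : G^T = G.
Hypothesis Gmu : loewner_le mu%:M G.
Hypothesis HG : loewner_le (hess f x) ((1 + M * rp / 2) *: G).

Let u := - (invmx G *m grad f x).
Let ep := M * rp / 2.
Let e := M * r / 2.
Let c := (1 + ep) * (1 + e).
Let J := avg_hess f x u.

Let x'E : x' = x + u. Proof. by case: stepE. Qed.
Let uE : x - invmx G *m grad f x - x = u.
Proof. by rewrite addrAC subrr add0r. Qed.
Let rE : r = lnorm f x u. Proof. by case: stepE => _ _ <-; rewrite uE. Qed.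
Let G'E : G' = SR1 J (c *: G) u.
Proof. by rewrite /c /e rE; case: stepE => _ <- _; rewrite uE. Qed.

Let r_ge0 : 0 <= r. Proof. by rewrite rE sqrtr_ge0. Qed.
Let ep0 : 0 <= ep. Proof. by rewrite divr_ge0// mulr_ge0// ssc.1. Qed.
Let e0 : 0 <= e. Proof. by rewrite divr_ge0// mulr_ge0// ssc.1. Qed.
Let ep1 : 0 < 1 + ep. Proof. by rewrite ltr_wpDr. Qed.
Let e1 : 0 < 1 + e. Proof. by rewrite ltr_wpDr. Qed.
Let c1 : 1 <= c. Proof. by rewrite mulr_ege1// lerDl. Qed.
Let c0 : 0 < c. Proof. by rewrite mulr_gt0. Qed.
Let pG : posdef G := posdef_ge mu0 Gsym Gmu.
Let Jsym : J^T = J := avg_hess_sym df dg x u.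
Let Jmu : loewner_le mu%:M J.
Proof. by apply: (avg_hess_ge_scalar df dg hess_ge0 ssc) => y; exact: (hessB y).1. Qed.
Let pJ : posdef J := posdef_ge mu0 Jsym Jmu.

Let JH : loewner_le J ((1 + e) *: hess f x).
Proof.
have := avg_hess_le_hess df dg hess_ge0 ssc x u (or_introl erefl).
by rewrite scale0r addr0 -rE.
Qed.
Let HJ : loewner_le (hess f x) ((1 + e) *: J).
Proof.
have := hess_le_avg_hess df dg hess_ge0 ssc x u (or_introl erefl).
by rewrite scale0r addr0 -rE.
Qed.
Let JH' : loewner_le J ((1 + e) *: hess f x').
Proof.
have := avg_hess_le_hess df dg hess_ge0 ssc x u (or_intror erefl).
by rewrite scale1r -rE -x'E.
Qed.
Let H'J : loewner_le (hess f x') ((1 + e) *: J).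
Proof.
have := hess_le_avg_hess df dg hess_ge0 ssc x u (or_intror erefl).
by rewrite scale1r -rE -x'E.
Qed.

(** The two factors of [c] come from [J <= (1 + e) H] and [H <= (1 + ep) G], with [H] the Hessian at
    [x]. *)
Let JG : loewner_le J (c *: G).
Proof.
apply/loewnerP => v; have /loewnerP/(_ v) := JH; have /loewnerP/(_ v) := HG.
rewrite !qformZm -/ep => h1 h2; apply: le_trans h2 _.
by rewrite /c [_ * (1 + e)]mulrC -mulrA ler_pM2l.
Qed.

Let Gu : G *m u = - grad f x.
Proof. by rewrite mulmxN mulKVmx// posdef_unit. Qed.

Let cGsym : (c *: G)^T = c *: G. Proof. by rewrite linearZ/= Gsym. Qed.

(** The step solves [G u = - grad f x], and [J u] is the change of gradient; this is the vector
    bounded in [SR1_potential]. *)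
Let grad'E : grad f x' = J *m u - G *m u.
Proof.
by rewrite (avg_hess_mul df dg hess_ge0 ssc) Gu opprK subrK x'E.
Qed.

Lemma sr1_step_sym : G'^T = G'.
Proof. by rewrite G'E SR1_sym. Qed.

Lemma sr1_step_ge : loewner_le mu%:M G'.
Proof.
have [/loewnerP JG' _] := SR1_bounds u Jsym cGsym JG.
apply/loewnerP => v; apply: le_trans (_ : qform J v <= _).
  by have /loewnerP := Jmu.
by rewrite G'E.
Qed.

(** Restores the hypothesis [HG] at the next iterate, with [r] as the previous length: [G']
    dominates [J], which dominates the Hessian at [x'] up to [1 + e]. *)
Lemma sr1_step_hess_le : loewner_le (hess f x') ((1 + M * r / 2) *: G').
Proof.
have [/loewnerP JG' _] := SR1_bounds u Jsym cGsym JG.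
apply/loewnerP => v; have /loewnerP/(_ v) := H'J.
by rewrite !qformZm -/e => /le_trans; apply; rewrite ler_pM2l// G'E.
Qed.

Lemma sr1_step_le : loewner_le G' (((1 + M * rp / 2) * (1 + M * r / 2)) *: G).
Proof. by rewrite G'E; have [] := SR1_bounds u Jsym cGsym JG. Qed.

Lemma sr1_step_length : 0 <= r <= (1 + M * rp / 2) * newton_dec f x.
Proof.
rewrite r_ge0/= -(@ler_pXn2r _ 2)// ?nnegrE ?mulr_ge0 ?sqrtr_ge0 ?(ltW ep1)//.
rewrite exprMn newton_dec_sqr rE sqr_sqrtr//.
have -> : qform (hess f x) u = qform (hess f x) (invmx G *m grad f x).
  by rewrite /u -scaleN1r qformZ sqrrN expr1n mul1r.
exact: qform_inv_step_le ep1 (hess_posdef x) pG HG.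
Qed.

Lemma sr1_step_potential : exists2 a, 0 <= a &
  ((1 + M * rp / 2) * (1 + M * r / 2)) ^+ n * \det G = (1 + a) * \det G' /\
  qform (invmx G') (grad f x') <=
  (a + ((1 + M * rp / 2) * (1 + M * r / 2) - 1) ^+ 2) *
     qform (invmx G) (grad f x).
Proof.
have pG' := posdef_ge mu0 sr1_step_sym sr1_step_ge.
have -> : qform (invmx G) (grad f x) = qform G u.
  rewrite -[grad f x]opprK -Gu -mulmxN qform_inv// -scaleN1r qformZ.
  by rewrite sqrrN expr1n mul1r.
rewrite grad'E G'E.
by apply: SR1_potential => //; rewrite -G'E.
Qed.

(** The contraction by [q] takes place in the metric of [J]. Entering it from the Hessian at [x] and
    leaving it for the Hessian at [x'] each cost [1 + e] in the squared decrement. *)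
Lemma sr1_step_decrement k q : 0 < k -> 0 < q -> loewner_le G (k *: mu%:M) ->
  (1 + M * rp / 2) * (1 + M * r / 2) - 1 <= q -> 1 - k^-1 <= q ->
  newton_dec f x' <= ((1 + M * r / 2) * q) * newton_dec f x.
Proof.
move=> k0 q0 Gk cq kq; rewrite -/e.
apply: newton_dec_le; [by rewrite mulr_ge0// ltW| |exact: sqrtr_ge0].
have GJ : loewner_le G (k *: J).
  apply/loewnerP => v; have /loewnerP/(_ v) := Gk; have /loewnerP/(_ v) := Jmu.
  by rewrite !qformZm => h1 /le_trans; apply; rewrite ler_pM2l.
apply: le_trans (qform_inv_le (grad f x') e1 pJ (hess_posdef x') JH') _.
have -> : grad f x' = grad f x - J *m (invmx G *m grad f x).
  by rewrite grad'E Gu opprK /u mulmxN addrC.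
have := quasi_newton_contraction (grad f x) c0 k0 q0 pJ pG JG GJ cq kq.
have := qform_inv_le (grad f x) e1 (hess_posdef x) pJ HJ.
rewrite newton_dec_sqr; move: (qform (invmx J) (grad f x)) (qform _ _) => a b ha hb.
have -> : ((1 + e) * q) ^+ 2 * qform (invmx (hess f x)) (grad f x) =
  (1 + e) * (q ^+ 2 * ((1 + e) * qform (invmx (hess f x)) (grad f x))) by ring.
rewrite ler_pM2l//; apply: le_trans hb _.
by rewrite ler_pM2l// exprn_gt0.
Qed.

End Step.

End Method.

(** ** Invariants of the run *)

(** Here [k] is [1 / kappa], and [m], [m0] are [M lambda] at the current and initial points. From
    [ep <= 1/8] follows [e <= 9/16 m], small enough against [k] for the factor [1 + e] to cost less
    than the gap between [2/3 k] and [k / 2]. *)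
Lemma step_arith (R : realType) (k m0 m ep e : R) : 0 < k -> k <= 1 ->
  0 <= m -> m <= m0 -> m0 <= k / 8 -> 0 <= ep -> ep <= m0 ->
  0 <= e -> 2 * e <= (1 + ep) * m ->
  [/\ 2 * e <= 2 * m, 2 * e <= 2 * m0, (1 + ep) * (1 + e) - 1 <= 1 / 3,
      1 / 3 <= 1 - 2 / 3 * k & (1 + e) * (1 - 2 / 3 * k) <= 1 - k / 2].
Proof.
move=> k0 k1 m_ge0 mm0 m0k ep0 epm e0 he.
have h1 : 0 <= (1 / 8 - ep) * m by rewrite mulr_ge0//; lra.
have h2 : 2 * e <= 9 / 8 * m by lra.
have h3 : 0 <= (1 / 8 - ep) * e by rewrite mulr_ge0//; lra.
have h4 : 0 <= e * k by rewrite mulr_ge0// ltW.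
by split; lra.
Qed.

(** The contraction lowers [4 z m] by at least [2 m], which pays for the increase [2 e] of the other
    terms. *)
Lemma budget_arith (R : realType) (z t ep e m m' : R) : z != 0 -> 0 <= z ->
  2 * e <= 2 * m -> m' <= (1 - z^-1 / 2) * m ->
  t + (ep + e) + e + 4 * z * m' <= t + ep + 4 * z * m.
Proof.
move=> z0 z_ge0 em mm'.
have h : z * m' <= z * m - m / 2.
  apply: le_trans (ler_wpM2l z_ge0 mm') _.
  by rewrite le_eqVlt; apply/orP; left; apply/eqP; field.
by lra.
Qed.

(** As [c - 1 <= 1], the square [(c - 1)^2] is absorbed by one extra factor [c]. *)
Lemma potential_arith (R : realType) (c a : R) : 1 <= c -> c - 1 <= 1 / 3 ->
  0 <= a -> 1 + (a + (c - 1) ^+ 2) <= c * (1 + a).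
Proof.
move=> c1 c3 a0; have h1 : 0 <= a * (c - 1) by rewrite mulr_ge0 ?subr_ge0.
have h2 : 0 <= (c - 1) * (1 - (c - 1)) by rewrite mulr_ge0 ?subr_ge0//; lra.
by lra.
Qed.

Section Run.
Variables (R : realType) (n : nat) (f : 'cV[R]_n -> R) (mu L M : R) (x0 : 'cV[R]_n).
Hypothesis mu0 : 0 < mu.
Hypothesis muL : mu <= L.
Hypothesis df : forall x, differentiable f x.
Hypothesis dg : forall x, differentiable (grad f) x.
Hypothesis hessB : forall x,
  loewner_le mu%:M (hess f x) /\ loewner_le (hess f x) L%:M.
Hypothesis ssc : strongly_self_concordant f M.
Hypothesis init : M * newton_dec f x0 <= ln (3 / 2) / (4 * (L / mu)).

Let kappa := L / mu.
Let lam x := newton_dec f x.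

Let L0 : 0 < L := lt_le_trans mu0 muL.
Let kappa1 : 1 <= kappa. Proof. by rewrite /kappa ler_pdivlMr// mul1r. Qed.
Let kappa0 : 0 < kappa. Proof. exact: lt_le_trans kappa1. Qed.
Let kV0 : 0 < kappa^-1. Proof. by rewrite invr_gt0. Qed.
Let kV1 : kappa^-1 <= 1. Proof. by rewrite invf_le1. Qed.
Let M0 : 0 <= M := ssc.1.
Let Mlam0 x : 0 <= M * lam x. Proof. by rewrite mulr_ge0// sqrtr_ge0. Qed.

Let ln32 : ln (3 / 2) <= 1 / 2 :> R.
Proof.
have -> : 3 / 2 = 1 + 1 / 2 :> R by field.
by apply: le_ln1Dx; lra.
Qed.

Let init_ln : 4 * kappa * (M * lam x0) <= ln (3 / 2).
Proof.
move: init; rewrite -/kappa ler_pdivlMr; last exact: mulr_gt0.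
by rewrite [_ * (4 * kappa)]mulrC.
Qed.

(** The form of the initial condition that [step_arith] takes, from [ln (3/2) <= 1/2]. *)
Let init8 : M * lam x0 <= kappa^-1 / 8.
Proof.
have : kappa^-1 * (4 * kappa * (M * lam x0)) <= kappa^-1 * (1 / 2).
  by rewrite ler_pM2l//; apply: le_trans ln32.
have -> : kappa^-1 * (4 * kappa * (M * lam x0)) = 4 * (M * lam x0).
  by field; rewrite gt_eqF.
by lra.
Qed.

(* After k steps, t is the sum over i < k of M (r_(i-1) + r_i) / 2, so that
   expR t bounds the product of the correction factors, and bs lists the ratios
   a_i + (c_i - 1)^2. *)
Definition run_geom (s : 'cV[R]_n * 'M[R]_n * R) (t : R) :=
  let: (x, G, rp) := s in
  [/\ [/\ 0 <= rp, G^T = G & loewner_le mu%:M G],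
      loewner_le (hess f x) ((1 + M * rp / 2) *: G),
      loewner_le G (expR t * L)%:M,
      M * rp <= 2 * (M * newton_dec f x0) & 0 <= t].

(* The weight 4 kappa is such that one contraction of newton_dec by
   1 - 1 / (2 kappa) pays for the growth M r of t + M rp / 2. *)
Definition run_decr (s : 'cV[R]_n * 'M[R]_n * R) (t : R) :=
  let: (x, G, rp) := s in
  newton_dec f x <= newton_dec f x0 /\
  t + M * rp / 2 + 4 * (L / mu) * (M * newton_dec f x) <=
    4 * (L / mu) * (M * newton_dec f x0).

(** In the exponent [n.+1], [n] powers come from the determinant of the scaled matrix and one from
    [potential_arith]. *)
Definition run_pot (s : 'cV[R]_n * 'M[R]_n * R) (t : R) (bs : seq R) :=
  let: (x, G, rp) := s in
  [/\ forall b, b \in bs -> 0 <= b,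
      qform (invmx G) (grad f x) <=
        \prod_(b <- bs) b * qform (invmx L%:M) (grad f x0) &
      \prod_(b <- bs) (1 + b) * \det G <= expR t ^+ n.+1 * L ^+ n].

(** The other terms of the budget in [run_decr] are nonnegative, so [t] is at most its initial
    value, hence at most [ln (3/2)]. *)
Lemma expR_run_le s t : run_geom s t -> run_decr s t -> expR t <= 3 / 2.
Proof.
case: s => [[x G] rp] [[rp0 _ _] _ _ _ t0] [_ ht].
rewrite -[3 / 2]lnK ?posrE ?divr_gt0// ler_expR.
apply: le_trans init_ln; apply: le_trans ht.
rewrite -addrA lerDl addr_ge0//; first by rewrite divr_ge0// mulr_ge0.
by rewrite mulr_ge0// mulr_ge0// ltW.
Qed.

Lemma run_step s t bs : run_geom s t -> run_decr s t -> run_pot s t bs ->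
  exists t' b, [/\ run_geom (sr1_step f M s) t', run_decr (sr1_step f M s) t' &
    run_pot (sr1_step f M s) t' (rcons bs b)].
Proof.
move=> hg hd; have Pt := expR_run_le hg hd.
case: s hg hd => [[x G] rp] [[rp0 Gs Gmu] HG GL Mrp t0] [hl ht] [bs0 hN hdet].
case stepE : (sr1_step f M (x, G, rp)) => [[x' G'] r].
have s1 := sr1_step_sym df dg stepE Gs.
have s2 := sr1_step_ge mu0 df dg hessB ssc stepE Gs HG.
have s3 := sr1_step_hess_le mu0 df dg hessB ssc stepE Gs HG.
have s4 := sr1_step_le mu0 df dg hessB ssc stepE Gs HG.
have /andP[r0 s5] := sr1_step_length mu0 df dg hessB ssc stepE rp0 Gs Gmu HG.
have [a a0 [s6 s7]] := sr1_step_potential mu0 df dg hessB ssc stepE rp0 Gs Gmu HG.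
have s8 := sr1_step_decrement mu0 df dg hessB ssc stepE rp0 Gs Gmu HG.
move: s3 s4 s5 s6 s7 s8; set ep := M * rp / 2; set e := M * r / 2.
set c := (1 + ep) * (1 + e) => s3 s4 s5 s6 s7 s8.
have ep0 : 0 <= ep by rewrite divr_ge0 ?mulr_ge0.
have e0 : 0 <= e by rewrite divr_ge0 ?mulr_ge0.
have ml : M * lam x <= M * lam x0 by rewrite ler_wpM2l.
have ml0 := Mlam0 x.
have e2 : 2 * e = M * r by rewrite /e mulrC divfK.
have epm : ep <= M * lam x0 by rewrite /ep ler_pdivrMr// [_ * 2]mulrC.
have he : 2 * e <= (1 + ep) * (M * lam x) by rewrite e2 mulrCA ler_wpM2l ?M0 ?s5.
have [em em0 cq3 q13 hq] := step_arith kV0 kV1 ml0 ml init8 ep0 epm e0 he.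
have c1 : 1 <= c by apply: mulr_ege1; rewrite lerDl.
pose q := 1 - 2 / 3 * kappa^-1.
have q0 : 0 < q by apply: lt_le_trans q13; rewrite divr_gt0.
have hlam : newton_dec f x' <= (1 + e) * q * newton_dec f x.
  (* The invariant [G <= expR t L I] reads [G <= (expR t kappa) mu I]. *)
  apply: (s8 (expR t * kappa)) => //.
  - by rewrite mulr_gt0 ?expR_gt0.
  - apply/loewnerP => v; have /loewnerP/(_ v) := GL.
    rewrite qformZm !qform_scalar => /le_trans; apply.
    by rewrite [in X in _ <= X]mulrA /kappa -[_ * (L / mu) * mu]mulrA divfK// gt_eqF.
  - exact: le_trans cq3 q13.
  (* The 2/3 in [q] is the inverse of the bound 3/2 on [expR t]. *)
  - rewrite /q lerD2l lerN2 [(expR t * _)^-1]invfM ler_pM2r//.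
    rewrite -[2 / 3]invf_div lef_pV2 ?posrE ?expR_gt0 ?divr_gt0//.
have hlam1 : newton_dec f x' <= (1 - kappa^-1 / 2) * newton_dec f x.
  by apply: le_trans hlam _; rewrite ler_wpM2r// sqrtr_ge0.
have hlam2 : M * lam x' <= (1 - kappa^-1 / 2) * (M * lam x).
  by rewrite mulrCA ler_wpM2l.
have c_exp : c <= expR (ep + e).
  by rewrite expRD ler_pM ?addr_ge0// expR_ge1Dx.
have G'0 : 0 <= \det G' by apply: le_trans (det_ge mu0 s1 s2); rewrite exprn_ge0// ltW.
have G0 : 0 <= \det G by apply: le_trans (det_ge mu0 Gs Gmu); rewrite exprn_ge0// ltW.
(* [ep + e] bounds the logarithm of [c], so [expR t] keeps dominating the product of the correction
   factors. *)
exists (t + (ep + e)), (a + (c - 1) ^+ 2); split.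
- split; [by split|exact: s3| | |].
  + apply/loewnerP => v; have /loewnerP/(_ v) := s4; have /loewnerP/(_ v) := GL.
    rewrite qformZm !qform_scalar => h1 h2; apply: le_trans h2 _.
    apply: (@le_trans _ _ (c * (expR t * L * dot v v))).
      by rewrite ler_pM2l// (lt_le_trans ltr01).
    rewrite expRD mulrA; apply: ler_wpM2r; first exact: dot_ge0.
    rewrite mulrA ler_pM2r// [expR t * _]mulrC.
    by rewrite ler_pM2r// expR_gt0.
  + rewrite -e2; exact: em0.
  + by rewrite !addr_ge0.
- split.
    apply: le_trans hl; apply: le_trans hlam1 _.
    by rewrite ler_piMl ?sqrtr_ge0// gerBl divr_ge0// ltW.
  apply: le_trans ht; rewrite -/kappa -/ep -/e -/(lam x') -/(lam x).
  by apply: budget_arith; rewrite ?gt_eqF// ltW.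
- have P0 : 0 <= \prod_(b <- bs) b by rewrite big_seq prodr_ge0.
  have b0 : 0 <= a + (c - 1) ^+ 2 by rewrite addr_ge0// sqr_ge0.
  split.
  + by move=> b; rewrite mem_rcons inE => /orP[/eqP->|/bs0].
  + rewrite -cats1 big_cat big_seq1 /=; apply: le_trans s7 _.
    by rewrite [_ * (a + _)]mulrC -mulrA ler_wpM2l.
  + rewrite -cats1 big_cat big_seq1 /=.
    have Q0 : 0 <= \prod_(b <- bs) (1 + b).
      by rewrite big_seq prodr_ge0// => b /bs0 ?; rewrite addr_ge0.
    have h : (1 + (a + (c - 1) ^+ 2)) * \det G' <= c ^+ n.+1 * \det G.
      rewrite [c ^+ n.+1]exprS -[leRHS]mulrA s6 [leRHS]mulrA ler_wpM2r//.
      exact: potential_arith.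
    rewrite -mulrA; apply: le_trans (ler_wpM2l Q0 h) _.
    rewrite mulrCA; apply: le_trans (ler_wpM2l _ hdet) _.
      by rewrite exprn_ge0// (le_trans ler01).
    rewrite mulrA ler_wpM2r ?exprn_ge0 ?(ltW L0)// expRD [(expR t * _) ^+ _]exprMn mulrC.
    rewrite ler_wpM2l ?exprn_ge0 ?expR_ge0// lerXn2r// nnegrE ?expR_ge0//.
    exact: le_trans c1.
Qed.

Lemma run_invariant k : exists t bs, [/\ size bs = k,
  run_geom (sr1_state f M L x0 k) t, run_decr (sr1_state f M L x0 k) t &
  run_pot (sr1_state f M L x0 k) t bs].
Proof.
elim: k => [|k [t [bs [sbs hg hd hp]]]].
  exists 0, [::]; split=> //=; split=> //.
  - split=> //; first by rewrite tr_scalar_mx.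
    by apply/loewnerP => v; rewrite !qform_scalar ler_wpM2r// dot_ge0.
  - rewrite mulr0 mul0r addr0 scale1r; exact: (hessB x0).2.
  - by apply/loewnerP => v; rewrite expR0 mul1r.
  - by rewrite mulr0 mulr_ge0.
  - by rewrite mulr0 mul0r !add0r.
  - by rewrite big_nil mul1r.
  - by rewrite big_nil mul1r expR0 expr1n mul1r det_scalar.
have [t' [b [hg' hd' hp']]] := run_step hg hd hp.
by exists t', (rcons bs b); rewrite size_rcons sbs.
Qed.

End Run.

(** * The explicit superlinear rate *)

Lemma budget_le (R : realType) (n : nat) (z P : R) : (0 < n)%N ->
  1 <= z -> 0 <= P -> P <= 3 / 2 ->
  P ^+ n.+1 * z ^+ n <= expR (2 * n%:R * ln (expR 1 * z)).
Proof.
move=> n0 z1 P0 P1; have z0 : 0 < z by apply: lt_le_trans z1.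
rewrite -natrM expRM_natl lnK ?posrE ?mulr_gt0 ?expR_gt0//.
(* From [3/2 <= 2 <= e] and [n + 1 <= 2 n] comes [P^(n+1) <= e^(2n)], and [z >= 1] gives
   [z^n <= z^(2n)]. *)
have e2 : 1 + 1 <= expR 1 :> R := expR_ge1Dx 1.
rewrite exprMn; apply: ler_pM; rewrite ?exprn_ge0//.
- exact: ltW.
- apply: (@le_trans _ _ (expR 1 ^+ n.+1)).
    by apply: lerXn2r; rewrite ?nnegrE ?expR_ge0//; lra.
  by rewrite ler_weXn2l; [|lra|rewrite mul2n -addnn -addn1 leq_add2l].
- by rewrite ler_weXn2l// leq_pmull.
Qed.

Unset Implicit Arguments.
Set Strict Implicit.
Set Printing Implicit Defensive.

Theorem theorem4 (R : realType) (n : nat) (f : 'cV[R]_n -> R)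
  (mu L M : R) (x0 : 'cV[R]_n) :
  0 < mu -> mu <= L ->
  (forall x, differentiable f x) ->
  (forall x, differentiable (grad f) x) ->
  (forall x, loewner_le (mu%:M) (hess f x) /\ loewner_le (hess f x) (L%:M)) ->
  strongly_self_concordant f M ->
  M * newton_dec f x0 <= ln (3 / 2) / (4 * (L / mu)) ->
  forall k : nat, (1 <= k)%N ->
    newton_dec f (sr1_iter f M L x0 k) <=
      (expR (2 * n%:R * ln (expR 1 * (L / mu)) / k%:R) - 1) `^ (k%:R / 2)
      * Num.sqrt (3 * (L / mu)) * newton_dec f x0.
Proof.
move=> mu0 muL df dg hessB ssc init k k1.
have L0 : 0 < L := lt_le_trans mu0 muL.
have z1 : 1 <= L / mu by rewrite ler_pdivlMr// mul1r.
have z0 : 0 < L / mu := lt_le_trans ltr01 z1.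
(* In dimension 0 the decrement is an empty sum; otherwise [n >= 1] makes [S] positive and
   [budget_le] applicable. *)
case: (posnP n) => [n0|n0].
  rewrite [leLHS](_ : _ = 0) ?mulr_ge0 ?powR_ge0 ?sqrtr_ge0//.
  move: (sr1_iter _ _ _ _ _) => x; rewrite /newton_dec qformE dotE.
  by rewrite big1 ?sqrtr0// => i; move: (ltn_ord i); rewrite {2}n0.
have [t [bs [sbs]]] := run_invariant mu0 muL df dg hessB ssc init k.
rewrite /sr1_iter; case: (sr1_state f M L x0 k) => [[x G] rp] /= hg hd [bs0 hN hdet].
have Pt := expR_run_le (s := (x, G, rp)) mu0 muL ssc init hg hd.
case: hg => [[rp0 Gs Gmu] _ GL _ t0].
have k0 : 0 < k%:R :> R by rewrite ltr0n.
set S := 2 * n%:R * ln (expR 1 * (L / mu)).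
(* Chosen so that [(1 + B)^k = expR S], the bound on the product of the [1 + b]. *)
pose B := expR (S / k%:R) - 1.
have S0 : 0 < S.
  rewrite mulr_gt0 ?mulr_gt0 ?ltr0n// ln_gt0//.
  by apply: (@lt_le_trans _ _ (expR 1)); rewrite ?expR_gt1// ler_peMr// expR_ge0.
have B0 : 0 < B by rewrite subr_gt0 expR_gt1 divr_gt0.
have Bk : (1 + B) ^+ k = expR S.
  by rewrite addrC subrK -expRM_natr divfK// gt_eqF.
have pG := posdef_ge mu0 Gs Gmu.
have pH := hess_posdef mu0 df dg hessB.
have prodB : \prod_(b <- bs) b <= B ^+ k.
  rewrite -sbs; apply: prod_le_of_prod1D => //; rewrite sbs Bk.
  apply: (le_trans _ (budget_le n0 z1 (expR_ge0 t) Pt)).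
  (* Since [mu^n <= \det G], the determinant bound [hdet] divided by [mu^n] turns [L^n] into
     [kappa^n]. *)
  rewrite expr_div_n mulrA ler_pdivlMr ?exprn_gt0//.
  apply: (le_trans _ hdet); apply: ler_wpM2l; last exact: det_ge.
  by rewrite big_seq prodr_ge0// => b /bs0 b_ge0; rewrite addr_ge0.
have N0 : qform (invmx L%:M) (grad f x0) <= newton_dec f x0 ^+ 2.
  rewrite (newton_dec_sqr mu0 df dg hessB).
  rewrite -[leRHS]mul1r; apply: qform_inv_le => //.
    apply: (posdef_ge L0); first by rewrite tr_scalar_mx.
    by apply/loewnerP => v; exact: lexx.
  by rewrite scale1r; exact: (hessB x0).2.
(* The potential controls the decrement through [G <= (3/2) L I <= 3 kappa mu I <= 3 kappa H], with
   [H] the Hessian at [x]. *)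
have lamN : newton_dec f x ^+ 2 <= 3 * (L / mu) * qform (invmx G) (grad f x).
  rewrite (newton_dec_sqr mu0 df dg hessB); apply: qform_inv_le => //.
    by rewrite mulr_gt0.
  apply/loewnerP => v; have /loewnerP/(_ v) := GL.
  have /loewnerP/(_ v) := (hessB x).1; rewrite qformZm !qform_scalar => h1 h2.
  apply: le_trans h2 _; apply: le_trans (ler_wpM2l _ h1); last first.
    by rewrite mulr_ge0// ltW.
  rewrite [leRHS]mulrA -[3 * _ * mu]mulrA divfK ?gt_eqF//.
  rewrite ler_wpM2r ?dot_ge0// ler_pM2r//.
  by apply: le_trans Pt _; rewrite ler_pdivrMr//; lra.
(* After squaring, the real power of exponent [k / 2] becomes the natural power [B ^+ k], and
   [lamN], [hN], [prodB], [N0] are chained. *)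
rewrite -(@ler_pXn2r _ 2)// ?nnegrE ?mulr_ge0 ?powR_ge0 ?sqrtr_ge0//.
have sqrtK : Num.sqrt (3 * (L / mu)) ^+ 2 = 3 * (L / mu).
  by rewrite sqr_sqrtr// mulr_ge0// ltW.
rewrite 2!exprMn sqrtK.
have -> : (B `^ (k%:R / 2)) ^+ 2 = B ^+ k.
  by rewrite -powR_mulrn ?powR_ge0// -powRrM divfK// powR_mulrn// ltW.
apply: le_trans lamN _; rewrite [B ^+ k * _]mulrC -[leRHS]mulrA ler_wpM2l//.
  by rewrite mulr_ge0// ltW.
apply: le_trans hN _; apply: ler_pM => //.
- by rewrite big_seq prodr_ge0.
- apply: posdef_ge0; apply: posdef_inv; apply: (posdef_ge L0); first by rewrite tr_scalar_mx.
  by apply/loewnerP => v; exact: lexx.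
Qed.
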